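(* Let $(a_{n,m})$ be the numbers determined by $a_{0,0}=1$, $a_{n,n}=0$ for $n\ge1$, $a_{n,0}=a_{n-1,0}+a_{n,1}$ for $n\ge 1$, and $a_{n,m}=a_{n-1,m-1}+a_{n,m+1}$ for $1\le m\le n-1$, extended by $a_{i,j}=0$ for $j>i$. Then the generating function $G(x,y)=\sum_{i\ge0}\sum_{j\ge0}a_{i,j}x^iy^j$ is $$G(x,y)=\frac{(1-xy)\left(1-\sqrt{1-4x}-2xy\right)}{2x\,(1-y+xy^2)}.$$
   Context: The identity is one of formal power series (equivalently of analytic functions near the origin, with $\frac{1-\sqrt{1-4x}}{2x}$ the Catalan generating function). *)

(* Defs.v *)
From HB Require Import structures.
From mathcomp Require Import all_boot all_order all_algebra.
From mathcomp Require Import boolp.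

Set Implicit Arguments.
Unset Strict Implicit.
Unset Printing Implicit Defensive.

Import GRing.Theory.
Local Open Scope ring_scope.

(* A record, so that the Cauchy product below does not compete with the
   pointwise ring structure on [nat -> R]. *)
Record fps (R : Type) := Fps { fps_coef :> nat -> R }.

Notation "{ 'fps' R }" := (fps R) (at level 0, format "{ 'fps'  R }").

HB.instance Definition _ (R : Type) := gen_eqMixin {fps R}.
HB.instance Definition _ (R : Type) := gen_choiceMixin {fps R}.

Lemma fpsP (R : Type) (f g : {fps R}) : f =1 g -> f = g.
Proof. by case: f g => [f] [g] /= /funext ->. Qed.

Section FpsRing.
Variable R : comNzRingType.
Implicit Types f g h : {fps R}.

Definition fps_zero : {fps R} := Fps (fun=> 0).
Definition fps_opp f : {fps R} := Fps (fun n => - f n).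
Definition fps_add f g : {fps R} := Fps (fun n => f n + g n).

Lemma fps_addA : associative fps_add.
Proof. by move=> f g h; apply: fpsP => n /=; rewrite addrA. Qed.

Lemma fps_addC : commutative fps_add.
Proof. by move=> f g; apply: fpsP => n /=; rewrite addrC. Qed.

Lemma fps_add0 : left_id fps_zero fps_add.
Proof. by move=> f; apply: fpsP => n /=; rewrite add0r. Qed.

Lemma fps_addN : left_inverse fps_zero fps_opp fps_add.
Proof. by move=> f; apply: fpsP => n /=; rewrite addNr. Qed.

HB.instance Definition _ :=
  GRing.isZmodule.Build {fps R} fps_addA fps_addC fps_add0 fps_addN.

Definition fps_const (c : R) : {fps R} := Fps (fun n => if n == 0%N then c else 0).
Definition fps_mul f g : {fps R} :=
  Fps (fun n => \sum_(i < n.+1) f i * g (n - i)%N).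

Definition fps_trunc n f : {poly R} := \poly_(i < n.+1) f i.

Lemma coef_fps_trunc n f i : (i <= n)%N -> (fps_trunc n f)`_i = f i.
Proof. by move=> le_in; rewrite coef_poly ltnS le_in. Qed.

Lemma fps_mul_trunc n f g i : (i <= n)%N ->
  fps_mul f g i = (fps_trunc n f * fps_trunc n g)`_i.
Proof.
move=> le_in; rewrite coefM; apply: eq_bigr => k _.
rewrite !coef_fps_trunc // ?(leq_trans _ le_in) ?leq_subr //.
by rewrite -ltnS.
Qed.

Lemma fps_mulC : commutative fps_mul.
Proof. by move=> f g; apply: fpsP => n; rewrite !(fps_mul_trunc _ _ (leqnn n)) mulrC. Qed.

Lemma fps_mul_trunc3 n f g h :
  fps_mul f (fps_mul g h) n
  = (fps_trunc n f * (fps_trunc n g * fps_trunc n h))`_n.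
Proof.
rewrite [RHS]coefM; apply: eq_bigr => k _.
by rewrite (@fps_mul_trunc n) ?leq_subr // coef_fps_trunc // -ltnS.
Qed.

Lemma fps_mulA : associative fps_mul.
Proof.
move=> f g h; apply: fpsP => n.
by rewrite [in RHS]fps_mulC !fps_mul_trunc3 mulrA [in RHS]mulrC.
Qed.

Lemma fps_mul1 : left_id (fps_const 1) fps_mul.
Proof.
move=> f; apply: fpsP => n /=; rewrite big_ord_recl /= mul1r subn0 big1 ?addr0 //.
by move=> i _; rewrite mul0r.
Qed.

Lemma fps_mulDl : left_distributive fps_mul fps_add.
Proof.
move=> f g h; apply: fpsP => n /=; rewrite -big_split /=.
by apply: eq_bigr => i _; rewrite mulrDl.
Qed.

Lemma fps_one_neq0 : fps_const 1 != 0.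
Proof. by apply/eqP => /(congr1 (fun f : {fps R} => f 0%N)) /= /eqP; rewrite oner_eq0. Qed.

HB.instance Definition _ := GRing.Zmodule_isComNzRing.Build {fps R}
  fps_mulA fps_mulC fps_mul1 fps_mulDl fps_one_neq0.

Definition fps_unit : {pred {fps R}} := fun f => `[< exists g, g * f = 1 >].
Definition fps_inv f : {fps R} :=
  if pselect (exists g, g * f = 1) is left ex_g then projT1 (cid ex_g) else f.

Lemma fps_mulV : {in fps_unit, left_inverse 1 fps_inv *%R}.
Proof.
move=> f /asboolP ex_g; rewrite /fps_inv.
by case: pselect => [{}ex_g|//]; case: (cid ex_g).
Qed.

Lemma fps_unitPl f g : g * f = 1 -> fps_unit f.
Proof. by move=> gf1; apply/asboolP; exists g. Qed.

Lemma fps_inv_out : {in [predC fps_unit], fps_inv =1 id}.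
Proof.
move=> f /negP f_nunit; rewrite /fps_inv.
by case: pselect => [ex_g|//]; case: f_nunit; apply/asboolP.
Qed.

HB.instance Definition _ := GRing.ComNzRing_hasMulInverse.Build {fps R}
  fps_mulV fps_unitPl fps_inv_out.

Definition fps_X : {fps R} := Fps (fun n => if n == 1%N then 1 else 0).

Lemma fps_coef0 n : (0 : {fps R}) n = 0. Proof. by []. Qed.
Lemma fps_coefD f g n : (f + g) n = f n + g n. Proof. by []. Qed.
Lemma fps_coefN f n : (- f) n = - f n. Proof. by []. Qed.
Lemma fps_coef1 n : (1 : {fps R}) n = if n == 0%N then 1 else 0. Proof. by []. Qed.
Lemma fps_coefM f g n : (f * g) n = \sum_(i < n.+1) f i * g (n - i)%N.
Proof. by []. Qed.

End FpsRing.

Lemma fps_integral (R : idomainType) (f g : {fps R}) :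
  f * g = 0 -> (f == 0) || (g == 0).
Proof.
move=> fg0; case: eqVneq => //= f0; case: eqVneq => //= g0; exfalso.
have ex_nz (h : {fps R}) : h != 0 -> exists n, h n != 0.
  move=> h0; apply: contrapT => h_all0; case/eqP: h0; apply: fpsP => n.
  by apply/eqP; rewrite fps_coef0; apply: contraPT isT => hn; case: h_all0; exists n.
case: (ex_minnP (ex_nz _ f0)) => m fm m_min.
case: (ex_minnP (ex_nz _ g0)) => n gn n_min.
have fg_mn : (f * g) (m + n)%N = f m * g n.
  have lt_m : (m < (m + n).+1)%N by rewrite ltnS leq_addr.
  rewrite fps_coefM (bigD1 (Ordinal lt_m)) //= addKn big1 ?addr0 // => i.
  rewrite -val_eqE /= => i_m.
  case: (ltngtP i m) i_m => // lt_im _.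
    case: (eqVneq (f i) 0) => [->|/m_min]; first by rewrite mul0r.
    by rewrite leqNgt lt_im.
  have lt_n : (m + n - i < n)%N.
    have i_le : (i <= m + n)%N by rewrite -ltnS.
    by rewrite ltn_subLR // ltn_add2r.
  case: (eqVneq (g (m + n - i)%N) 0) => [->|/n_min]; first by rewrite mulr0.
  by rewrite leqNgt lt_n.
by move/eqP: fg_mn; rewrite fg0 fps_coef0 eq_sym mulf_eq0 (negbTE fm) (negbTE gn).
Qed.

HB.instance Definition _ (R : idomainType) :=
  GRing.ComUnitRing_isIntegral.Build {fps R} (@fps_integral R).

Section FpsSqrt.
Variable R : comUnitRingType.
Implicit Types f s : {fps R}.

Fixpoint fps_sqrt_seq f n : seq R :=
  if n is m.+1 then
    let s := fps_sqrt_seq f m in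
    rcons s (if m == 0%N then 1
             else (f m - \sum_(1 <= k < m) s`_k * s`_(m - k)%N) / 2)
  else [::].

(* The square root with constant term 1, obtained by solving [s ^+ 2 = f]
   coefficient by coefficient.  Meaningful when [f 0 = 1] and 2 is a unit;
   see [fps_sqrtK] and [fps_sqrt_uniq]. *)
Definition fps_sqrt f : {fps R} := Fps (fun n => (fps_sqrt_seq f n.+1)`_n).

Lemma fps_sqrt_seqS f m : fps_sqrt_seq f m.+1 =
  rcons (fps_sqrt_seq f m)
    (if m == 0%N then 1
     else (f m - \sum_(1 <= k < m)
       (fps_sqrt_seq f m)`_k * (fps_sqrt_seq f m)`_(m - k)%N) / 2).
Proof. by []. Qed.

Lemma size_fps_sqrt_seq f n : size (fps_sqrt_seq f n) = n.
Proof. by elim: n => //= n IHn; rewrite size_rcons IHn. Qed.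

Lemma nth_fps_sqrt_seq f n i : (i < n)%N -> (fps_sqrt_seq f n)`_i = fps_sqrt f i.
Proof.
elim: n => // n IHn; rewrite ltnS leq_eqVlt => /predU1P[-> //|lt_in].
by rewrite [fps_sqrt_seq _ _]/= nth_rcons size_fps_sqrt_seq lt_in IHn.
Qed.

Lemma fps_sqrt0 f : fps_sqrt f 0%N = 1.
Proof. by []. Qed.

Lemma fps_sqrtS f n : fps_sqrt f n.+1 =
  (f n.+1 - \sum_(1 <= k < n.+1) fps_sqrt f k * fps_sqrt f (n.+1 - k)%N) / 2.
Proof.
transitivity (fps_sqrt_seq f n.+2)`_n.+1 => //.
rewrite fps_sqrt_seqS nth_rcons size_fps_sqrt_seq ltnn eqxx; congr ((_ - _) / _).
apply: eq_big_nat => k /andP[k_gt0 k_lt].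
by rewrite !nth_fps_sqrt_seq // ltn_subrL k_gt0.
Qed.

Lemma fps_sqr_coefS s n : s 0%N = 1 ->
  (s ^+ 2) n.+1 = s n.+1 * 2 + \sum_(1 <= k < n.+1) s k * s (n.+1 - k)%N.
Proof.
move=> s0; rewrite expr2 fps_coefM.
rewrite -(big_mkord xpredT (fun k => s k * s (n.+1 - k)%N)).
rewrite big_nat_recl // big_nat_recr //= subnn s0 subn0 mul1r mulr1.
by rewrite big_add1 /= addrA addrAC mulr_natr mulr2n.
Qed.

Lemma fps_sqrtK f : (2 : R) \is a GRing.unit -> f 0%N = 1 -> fps_sqrt f ^+ 2 = f.
Proof.
move=> u2 f0; apply: fpsP => -[|n].
  by rewrite expr2 fps_coefM big_ord_recl big_ord0 /= mul1r addr0 f0.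
by rewrite fps_sqr_coefS ?fps_sqrt0 // fps_sqrtS divrK // subrK.
Qed.

Lemma fps_sqrt_uniq f s : (2 : R) \is a GRing.unit ->
  s 0%N = 1 -> s ^+ 2 = f -> s = fps_sqrt f.
Proof.
move=> u2 s0 sE; apply: fpsP => n.
elim/ltn_ind: n => -[|n] IHn; first by rewrite s0 fps_sqrt0.
rewrite fps_sqrtS; apply: (mulIr u2); rewrite divrK //.
move/(congr1 (fun h : {fps R} => h n.+1)): sE; rewrite fps_sqr_coefS // => <-.
rewrite -[LHS](addrK (\sum_(1 <= k < n.+1) s k * s (n.+1 - k)%N)).
congr (_ - _); apply: eq_big_nat => k /andP[k_gt0 k_lt].
by rewrite !IHn // ltn_subrL k_gt0.
Qed.

End FpsSqrt.

(* Q[[x, y]] as Q[[y]][[x]]: the coefficient of x^i y^j in [f] is [f i j]. *)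
Notation fps2 := {fps {fps rat}}.

Definition X : fps2 := fps_X {fps rat}.
Definition Y : fps2 := fps_const (fps_X rat).

Definition gen_fun (a : nat -> nat -> rat) : fps2 := Fps (fun i => Fps (a i)).

(* Q[[x, y]] inside its field of fractions. *)
Notation "f %:F" := (@FracField.tofrac fps2 f) : ring_scope.

(* Main.v *)
Require Import Defs.
From mathcomp Require Import all_boot all_order all_algebra.
From mathcomp Require Import zify ring.
Import GRing.Theory.
Local Open Scope ring_scope.

(** Kernel method.  Write [K(y) = 1 - y + x y^2] and let [c(x)] be the
    generating function of the column [a_{n,0}].  The recurrence says
    [G K(y) = (1 - x y) (c - y)], so it remains to find [c].  Eliminating
    [c - y] between this and [K(c) = K(y) + (c - y) (x c + x y - 1)] gives
    [(1 - x y) K(c) = K(y) H] with [H = (1 - x y) + G (x c + x y - 1)].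
    Here [K(c)] is free of [y], the coefficient of each [x^n] in [H] is a
    polynomial in [y], and the one of [x^0] in [K(y)] is [1 - y]; comparing
    coefficients of [x^n] and letting [y = 1] forces [K(c) = 0].  Hence
    [(1 - 2 x c)^2 = 1 - 4 x]. *)

Section Coefficients.
Variable R : comNzRingType.

Lemma fps_coefCM (c : R) (f : {fps R}) n : (fps_const c * f) n = c * f n.
Proof.
rewrite fps_coefM big_ord_recl /= subn0 big1 ?addr0 // => i _.
by rewrite mul0r.
Qed.

Lemma fps_coefXM (f : {fps R}) n :
  (fps_X R * f) n = if n is m.+1 then f m else 0.
Proof.
rewrite fps_coefM big_ord_recl /= mul0r add0r.
case: n => [|n]; first by rewrite big_ord0.
rewrite big_ord_recl /= mul1r subSS subn0 big1 ?addr0 // => i _.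
by rewrite mul0r.
Qed.

Lemma fps_coef_sum I (r : seq I) (P : pred I) (F : I -> {fps R}) n :
  (\sum_(i <- r | P i) F i) n = \sum_(i <- r | P i) F i n.
Proof. exact: (big_morph (fun f : {fps R} => f n)). Qed.

Lemma fps_coefM_low (f g : {fps R}) n :
  (forall i, (i < n)%N -> f i = 0) -> (f * g) n = f n * g 0%N.
Proof.
move=> f_low; rewrite fps_coefM big_ord_recr /= subnn big1 ?add0r // => i _.
by rewrite f_low ?mul0r.
Qed.

End Coefficients.

Section BivariateCoefficients.
Implicit Type f : fps2.

Lemma fps2_coefXM f n : (X * f) n = if n is m.+1 then f m else 0.
Proof. exact: fps_coefXM. Qed.

Lemma fps2_coefYM f n m : (Y * f) n m = if m is k.+1 then f n k else 0.
Proof. by rewrite fps_coefCM fps_coefXM. Qed.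

End BivariateCoefficients.

(* Degree in [y] at most [k * n] in the coefficient of [x^n]: free of [y] for
   [k = 0], polynomial in [y] row by row for every [k]. *)
Definition y_bounded k (f : fps2) := forall n m, (k * n < m)%N -> f n m = 0.

Section YBounded.
Variable k : nat.
Implicit Types f g : fps2.

Lemma y_bounded1 : y_bounded k 1.
Proof. by move=> [|n] [|m]; rewrite ?muln0. Qed.

Lemma y_boundedX : y_bounded k X.
Proof. by move=> [|[|n]] [|m]. Qed.

Lemma y_boundedD f g : y_bounded k f -> y_bounded k g -> y_bounded k (f + g).
Proof. by move=> hf hg n m lt; rewrite !fps_coefD hf // hg // addr0. Qed.

Lemma y_boundedN f : y_bounded k f -> y_bounded k (- f).
Proof. by move=> hf n m lt; rewrite !fps_coefN hf // oppr0. Qed.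

Lemma y_boundedM f g : y_bounded k f -> y_bounded k g -> y_bounded k (f * g).
Proof.
move=> hf hg n m lt; rewrite fps_coefM fps_coef_sum big1 // => i _.
rewrite fps_coefM big1 // => j _.
(* Since [k * i + k * (n - i) = k * n < m], at least one of the two factors lies beyond its degree
   bound. *)
case: (ltnP (k * i) j) => le_j; first by rewrite hf ?mul0r.
rewrite hg ?mulr0 // mulnBr.
have : (k * i <= k * n)%N by rewrite leq_mul2l -ltnS ltn_ord orbT.
lia.
Qed.

End YBounded.

Lemma y_boundedXY : y_bounded 1 (X * Y).
Proof.
move=> [|[|n]] m; rewrite fps2_coefXM // mul1n => lt.
by rewrite /Y /fps_const /=; case: eqP lt => // ->.
Qed.

(** A function of [z], since it is evaluated both at [Y] and at the column series [c]. *)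
Definition kernel (z : fps2) : fps2 := 1 - z + X * z ^+ 2.

Lemma kernelY0 : kernel Y 0%N = 1 - fps_X rat.
Proof. by rewrite /kernel !fps_coefD fps2_coefXM addr0. Qed.

Lemma kernelY_neq0 : kernel Y != 0.
Proof.
apply/eqP => /(congr1 (fun f : fps2 => f 0%N 0%N)).
by rewrite kernelY0.
Qed.

(* [h (1 - y) = d] with [d] constant makes all coefficients of [h] equal. *)
Lemma const_multiple_1subX (h d : {fps rat}) N :
  h * (1 - fps_X rat) = d ->
  (forall m, (0 < m)%N -> d m = 0) -> (forall m, (N < m)%N -> h m = 0) ->
  h = 0 /\ d = 0.
Proof.
move=> hd d_const h_poly.
have coefE m : h m - (if m is k.+1 then h k else 0) = d m.
  by rewrite -hd mulrBr mulr1 fps_coefD fps_coefN mulrC fps_coefXM.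
have h_cst m : h m = h 0%N.
  elim: m => // m IHm; apply/eqP; rewrite -IHm -subr_eq0.
  by rewrite (coefE m.+1) d_const.
have h0 : h = 0 by apply: fpsP => m; rewrite h_cst -(h_cst N.+1) h_poly.
by rewrite -hd h0 mul0r.
Qed.

Lemma kernel_elimination (d h : fps2) :
  y_bounded 0 d -> y_bounded 1 h -> (1 - X * Y) * d = h * kernel Y -> d = 0.
Proof.
move=> d_y h_y dh.
(* The vanishing of [h] is carried along: once all lower coefficients of [d] and [h] are zero, the
   coefficient of x^n in the equation reduces to [d n = h n * (1 - y)]. *)
suff both n : h n = 0 /\ d n = 0 by apply: fpsP => n; case: (both n).
elim/ltn_ind: n => n IHn.
apply: (@const_multiple_1subX _ _ n).
- rewrite -kernelY0 -fps_coefM_low -?dh => [|i /IHn[]//].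
  rewrite [_ * d]mulrC fps_coefM_low => [|i /IHn[]//].
  by rewrite fps_coefD fps_coefN fps2_coefXM subr0 mulr1.
- by move=> m m_gt0; rewrite d_y // mul0n.
- by move=> m lt_nm; rewrite h_y // mul1n.
Qed.

(** The square root is taken in x over the coefficient ring Q[[y]], so uniqueness requires 2 to be
    invertible there. *)
Lemma fps_two_unit : (2 : {fps rat}) \is a GRing.unit.
Proof.
apply: (@fps_unitPl _ _ (fps_const (2^-1 : rat))).
by apply: fpsP => -[|n]; rewrite fps_coefCM // mulr0.
Qed.

Section GeneratingFunction.
Variable a : nat -> nat -> rat.
Hypothesis a_00 : a 0%N 0%N = 1.
Hypothesis a_nn : forall n : nat, (1 <= n)%N -> a n n = 0.
Hypothesis a_n0 :
  forall n : nat, (1 <= n)%N -> a n 0%N = a (n - 1)%N 0%N + a n 1%N.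
Hypothesis a_nm : forall n m : nat, (1 <= m)%N -> (m <= n - 1)%N ->
  a n m = a (n - 1)%N (m - 1)%N + a n (m + 1)%N.
Hypothesis a_out : forall i j : nat, (i < j)%N -> a i j = 0.

Let G := gen_fun a.
(** Column 0 is embedded in Q[[x, y]] as a series free of y, so that it can be substituted into
    [kernel]. *)
Let c : fps2 := Fps (fun n => fps_const (a n 0%N)).

Lemma gen_fun_kernel : G * kernel Y = (1 - X * Y) * (c - Y).
Proof.
have -> : G * kernel Y = G - Y * G + X * (Y * (Y * G)).
  by rewrite /kernel; ring.
have -> : (1 - X * Y) * (c - Y) = c - Y - X * (Y * c) + X * (Y * Y) by ring.
apply: fpsP => n; apply: fpsP => m.
rewrite !(fps_coefD, fps_coefN, fps2_coefXM).
case: n => [|n].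
  by case: m => [|[|m]]; rewrite ?fps2_coefYM /= ?a_00 ?a_out.
case: m => [|[|m]]; rewrite !fps2_coefYM /= ?fps2_coefYM /=.
- by rewrite oppr0 !addr0.
- rewrite a_n0 // subn1 /=.
  case: n => [|n] /=; ring.
(* The coefficient of x^(n+1) y^(m+2) calls for the recurrence at (n+1, m+1), which holds for
   [m < n]. For [n < m] every entry is zero. For [m = n] only [a n n] is left; it is 1 exactly at
   [n = 0], which yields the term x y^2 on the right. *)
case: (ltngtP m n) => [lt_mn|lt_nm|->].
- rewrite (a_nm n.+1 m.+1) ?subn1 ?addn1 //=.
  case: n lt_mn => [//|n] _ /=; ring.
- rewrite !a_out //; last lia.
  case: m lt_nm => [//|m] _; case: n => [|n] /=; ring.
- rewrite a_out // a_nn //.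
  by case: n => [|n] /=; rewrite ?a_00 ?a_nn.
Qed.

Lemma kernel_col0 : kernel c = 0.
Proof.
have c_y k : y_bounded k c by move=> n [|m]; rewrite ?ltn0.
(* Triangularity makes each row of [G] a polynomial in y, which is what allows setting y = 1. *)
have G_y : y_bounded 1 G by move=> n m; rewrite mul1n; apply: a_out.
have one_subXY_y : y_bounded 1 (1 - X * Y).
  by apply: y_boundedD; [apply: y_bounded1 | apply/y_boundedN/y_boundedXY].
apply: (@kernel_elimination _ (1 - X * Y + G * (X * c - (1 - X * Y)))).
- apply: y_boundedD; first apply: y_boundedD.
  + exact: y_bounded1.
  + exact: y_boundedN.
  + by rewrite expr2; do ![apply: y_boundedM => //]; apply: y_boundedX.
- apply: y_boundedD => //; apply: y_boundedM => //.
  apply: y_boundedD; last exact: y_boundedN.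
  by apply: y_boundedM => //; apply: y_boundedX.
rewrite [RHS]mulrDl [G * _ * _]mulrAC gen_fun_kernel /kernel; ring.
Qed.

(** Completing the square gives (1 - 2 x c)^2 = 1 - 4 x + 4 x K(c); the constant term 1 selects the
    branch. *)
Lemma sqrt_col0 : fps_sqrt (1 - 4 * X) = 1 - 2 * X * c.
Proof.
apply/esym/fps_sqrt_uniq; first exact: fps_two_unit.
  by rewrite -mulrA mulrCA fps_coefD fps_coefN fps2_coefXM subr0.
transitivity (1 - 4 * X + 4 * X * kernel c); first by rewrite /kernel; ring.
by rewrite kernel_col0 mulr0 addr0.
Qed.

Lemma gen_fun_numerator :
  G * (2 * X * kernel Y)
  = (1 - X * Y) * (1 - fps_sqrt (1 - 4 * X) - 2 * X * Y).
Proof. by rewrite mulrCA gen_fun_kernel sqrt_col0; ring. Qed.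

End GeneratingFunction.

Lemma fps2_2X_neq0 : 2 * X != 0 :> fps2.
Proof.
apply/eqP => /(congr1 (fun f : fps2 => f 1%N 0%N)).
by rewrite mulrC fps2_coefXM.
Qed.

Theorem theorem2 (a : nat -> nat -> rat)
  (a_00 : a 0%N 0%N = 1)
  (a_nn : forall n : nat, (1 <= n)%N -> a n n = 0)
  (a_n0 : forall n : nat, (1 <= n)%N -> a n 0%N = a (n - 1)%N 0%N + a n 1%N)
  (a_nm : forall n m : nat, (1 <= m)%N -> (m <= n - 1)%N ->
            a n m = a (n - 1)%N (m - 1)%N + a n (m + 1)%N)
  (a_out : forall i j : nat, (i < j)%N -> a i j = 0) :
  (gen_fun a)%:F
  = ((1 - X * Y) * (1 - fps_sqrt (1 - 4 * X) - 2 * X * Y))%:F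
    / (2 * X * (1 - Y + X * Y ^+ 2))%:F.
Proof.
rewrite -/(kernel Y) -(gen_fun_numerator _ a_00 a_nn a_n0 a_nm a_out).
(* [2 * X] is not a unit among power series; in the field of fractions a nonzero denominator
   suffices to cancel. *)
rewrite tofracM mulfK // tofrac_eq0 mulf_neq0 ?fps2_2X_neq0 //.
exact: kernelY_neq0.
Qed.
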